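(* Let $\Bbbk$ be a field and let $H_4$ be the Sweedler algebra over $\Bbbk$. There exists a CH--RB--operator $B\colon H_4\to H_4$ which is not a coalgebra homomorphism, i.e. such that $\Delta B\neq (B\otimes B)\Delta$.
   Context: The Sweedler algebra $H_4$ is the 4-dimensional Hopf algebra over $\Bbbk$ with basis $1,g,x,gx$, generated as an algebra by $g,x$ with relations $g^2=1$, $x^2=0$, $xg=-gx$, with comultiplication $\Delta(g)=g\otimes g$, $\Delta(x)=x\otimes 1+g\otimes x$, $\Delta(gx)=gx\otimes g+1\otimes gx$, counit $\varepsilon(g)=1$, $\varepsilon(x)=\varepsilon(gx)=0$, and antipode $S(g)=g$, $S(x)=-gx$, $S(gx)=x$. A CH--RB--operator (cocommutative Hopf Rota--Baxter operator) on $H_4$ is a linear map $B\colon H_4\to H_4$ such that for all $a,b\in H_4$ $$B(a)B(b)=B\bigl(a_{(1)}\,B(a_{(2)})\,b\,S(B(a_{(3)}))\bigr),$$ where, in Sweedler notation, $(\Delta\otimes\mathrm{id})\Delta(a)=a_{(1)}\otimes a_{(2)}\otimes a_{(3)}$. The paper's condition for $B$ to be a coalgebra homomorphism is $(B\otimes B)\Delta=\Delta B$. *)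

(* Defs.v *)
From HB Require Import structures.
From mathcomp Require Import all_boot all_algebra.
From mathcomp Require Import ring.

Set Implicit Arguments.
Unset Strict Implicit.
Unset Printing Implicit Defensive.

Import GRing.Theory.
Local Open Scope ring_scope.

(* An element of the tensor product of U and V is the matrix of its           *)
(* coordinates on the products of the bases vbasis {:U} and vbasis {:V};      *)
(* tens_lift_linear, tens_liftE and tens_spanE are its universal property.    *)
Definition tensor (k : fieldType) (U V : vectType k) : Type :=
  'M[k]_(\dim {:U}, \dim {:V}).

HB.instance Definition _ (k : fieldType) (U V : vectType k) :=
  Vector.on (tensor U V).

Definition tens (k : fieldType) (U V : vectType k) (u : U) (v : V) :
    tensor U V :=
  \matrix_(i, j) (coord (vbasis {:U}) i u * coord (vbasis {:V}) j v).

Notation "u \ox v" := (tens u v) (at level 40, left associativity) : ring_scope.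

Definition tens_lift (k : fieldType) (U V : vectType k) (W : lmodType k)
    (f : U -> V -> W) (t : tensor U V) : W :=
  \sum_i \sum_j t i j *: f (vbasis {:U})`_i (vbasis {:V})`_j.

Definition tens_map (k : fieldType) (U V U' V' : vectType k)
    (f : U -> U') (g : V -> V') : tensor U V -> tensor U' V' :=
  tens_lift (fun u v => f u \ox g v).

Section TensorBilinear.
Variables (k : fieldType) (U V : vectType k).

Lemma tens_linearl (v : V) : linear (fun u : U => u \ox v).
Proof. by move=> c u u'; apply/matrixP=> i j; rewrite !mxE linearP /=; ring. Qed.

Lemma tens_linearr (u : U) : linear (fun v : V => u \ox v).
Proof. by move=> c v v'; apply/matrixP=> i j; rewrite !mxE linearP /=; ring. Qed.

End TensorBilinear.

Section TensorTheory.
Variables (k : fieldType) (U V : vectType k).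

Lemma tens_lift_linear (W : lmodType k) (f : U -> V -> W) :
  linear (tens_lift f).
Proof.
move=> c t t'; rewrite /tens_lift scaler_sumr -big_split /=.
apply: eq_bigr => i _; rewrite scaler_sumr -big_split /=.
by apply: eq_bigr => j _; rewrite !mxE scalerDl scalerA.
Qed.

Lemma tens_lift_linearp (P W : lmodType k) (F : P -> U -> V -> W)
    (t : tensor U V) :
  (forall u v, linear (fun p => F p u v)) -> linear (fun p => tens_lift (F p) t).
Proof.
move=> FP c p p'; rewrite /tens_lift scaler_sumr -big_split /=.
apply: eq_bigr => i _; rewrite scaler_sumr -big_split /=.
by apply: eq_bigr => j _; rewrite FP scalerDr !scalerA mulrC.
Qed.

Lemma tens_liftE (W : lmodType k) (f : U -> V -> W) (u : U) (v : V) :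
  (forall v', linear (f^~ v')) -> (forall u', linear (f u')) ->
  tens_lift f (u \ox v) = f u v.
Proof.
move=> fl fr.
pose gl v' : {linear U -> W} :=
  HB.pack (f^~ v') (GRing.isLinear.Build _ _ _ _ _ (fl v')).
pose gr u' : {linear V -> W} :=
  HB.pack (f u') (GRing.isLinear.Build _ _ _ _ _ (fr u')).
rewrite [in RHS](coord_vbasis (memvf u)) -[RHS]/(gl v _) linear_sum /=.
apply: eq_bigr => i _; rewrite -[f _ v]/(gl v _) linearZ /=.
rewrite [in RHS](coord_vbasis (memvf v)).
rewrite -[f _ (\sum_i0 _)]/(gr _ _) linear_sum scaler_sumr /=.
apply: eq_bigr => j _; rewrite -[f _ (_ *: _)]/(gr _ _) linearZ /=.
by rewrite mxE scalerA.
Qed.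

Lemma tens_spanE (t : tensor U V) :
  t = \sum_i \sum_j t i j *: ((vbasis {:U})`_i \ox (vbasis {:V})`_j).
Proof.
apply/matrixP=> i j; rewrite summxE (bigD1 i) //= summxE (bigD1 j) //=.
have fb (X : vectType k) : free (vbasis {:X}) := basis_free (vbasisP {:X}).
rewrite !mxE !coord_free // !eqxx !mulr1 big1 ?addr0 ?big1 ?addr0 //.
- move=> i' ne; rewrite summxE big1 // => j' _; rewrite !mxE !coord_free //.
  by rewrite (negPf ne) mul0r mulr0.
- move=> j' ne; rewrite !mxE !coord_free //.
  by rewrite (negPf ne) !mulr0.
Qed.

HB.instance Definition _ (W : lmodType k) (f : U -> V -> W) :=
  GRing.isLinear.Build k (tensor U V) W _ (tens_lift f) (tens_lift_linear f).

HB.instance Definition _ (U' V' : vectType k) (f : U -> U') (g : V -> V') :=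
  GRing.isLinear.Build k (tensor U V) (tensor U' V') _ (tens_map f g)
    (tens_lift_linear _).

Lemma tens_mapE (U' V' : vectType k) (f : {linear U -> U'})
    (g : {linear V -> V'}) (u : U) (v : V) :
  tens_map f g (u \ox v) = f u \ox g v.
Proof.
rewrite /tens_map tens_liftE // => [v'|u'] c x y; rewrite linearP /=.
  exact: tens_linearl.
exact: tens_linearr.
Qed.

End TensorTheory.

(* Coordinates in the basis 1, g, x, gx. *)
Definition H4 (k : fieldType) : Type := 'rV[k]_4.

HB.instance Definition _ (k : fieldType) := Vector.on (H4 k).

Section Sweedler.
Variable k : fieldType.
Implicit Types a b c : H4 k.

Definition e1 : H4 k := delta_mx 0 (inord 0).
Definition eg : H4 k := delta_mx 0 (inord 1).
Definition ex : H4 k := delta_mx 0 (inord 2).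
Definition egx : H4 k := delta_mx 0 (inord 3).

(* The linear map from H4 sending 1, g, x, gx to v1, vg, vx, vgx. *)
Definition H4_ext (V : lmodType k) (v1 vg vx vgx : V) a : V :=
  a 0 (inord 0) *: v1 + a 0 (inord 1) *: vg +
  a 0 (inord 2) *: vx + a 0 (inord 3) *: vgx.

Definition H4_mul a b : H4 k :=
  H4_ext (H4_ext  e1     eg   ex   egx b)
         (H4_ext  eg     e1   egx  ex  b)
         (H4_ext  ex  (- egx) 0    0   b)
         (H4_ext  egx (- ex)  0    0   b) a.

Lemma H4P a b : a = b <->
  [/\ a 0 (inord 0) = b 0 (inord 0), a 0 (inord 1) = b 0 (inord 1),
      a 0 (inord 2) = b 0 (inord 2) & a 0 (inord 3) = b 0 (inord 3)].
Proof.
split=> [-> // | [h0 h1 h2 h3]]; apply/rowP => j; rewrite -(inord_val j).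
by case: j => [[|[|[|[|//]]]] ?].
Qed.

Lemma H4_coordE :
  (forall i j : 'I_4, (delta_mx 0 i : H4 k) 0 j = (j == i)%:R) *
  (forall a b i, (a + b) 0 i = a 0 i + b 0 i) *
  (forall a i, (- a) 0 i = - a 0 i) *
  (forall (c : k) a i, (c *: a) 0 i = c * a 0 i) *
  (forall i, (0 : H4 k) 0 i = 0).
Proof. by do !split=> *; rewrite mxE. Qed.

Lemma inord4E (i j : nat) : (i < 4)%N -> (j < 4)%N ->
  ((inord i : 'I_4) == inord j) = (i == j).
Proof. by move=> hi hj; rewrite -val_eqE /= !inordK. Qed.

Lemma H4_extC (v1 vg vx vgx : H4 k) a i :
  H4_ext v1 vg vx vgx a 0 i =
    a 0 (inord 0) * v1 0 i + a 0 (inord 1) * vg 0 i +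
    a 0 (inord 2) * vx 0 i + a 0 (inord 3) * vgx 0 i.
Proof. by rewrite /H4_ext !H4_coordE. Qed.

Local Notation "a `1" := (fun_of_matrix a 0 (inord 0)) (at level 2).
Local Notation "a `g" := (fun_of_matrix a 0 (inord 1)) (at level 2).
Local Notation "a `x" := (fun_of_matrix a 0 (inord 2)) (at level 2).
Local Notation "a `gx" := (fun_of_matrix a 0 (inord 3)) (at level 2).

Lemma H4_mulE a b :
  ((H4_mul a b)`1 = a`1 * b`1 + a`g * b`g) *
  ((H4_mul a b)`g = a`1 * b`g + a`g * b`1) *
  ((H4_mul a b)`x = a`1 * b`x + a`g * b`gx + a`x * b`1 - a`gx * b`g) *
  ((H4_mul a b)`gx = a`1 * b`gx + a`g * b`x + a`gx * b`1 - a`x * b`g).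
Proof.
rewrite /H4_mul !H4_extC /e1 /eg /ex /egx !H4_coordE !inord4E //=.
rewrite !(mulr0, mulr1, addr0, add0r, mulrN, oppr0).
do !split=> //; ring.
Qed.

Ltac H4_coords :=
  apply/H4P; rewrite !(H4_mulE, H4_coordE);
  rewrite /e1 ?H4_coordE ?inord4E //=; split; ring.

Fact H4_mulA : associative H4_mul.   Proof. by move=> a b c; H4_coords. Qed.
Fact H4_mul1r : left_id e1 H4_mul.   Proof. by move=> a; H4_coords. Qed.
Fact H4_mulr1 : right_id e1 H4_mul.  Proof. by move=> a; H4_coords. Qed.
Fact H4_mulDl : left_distributive H4_mul +%R.
Proof. by move=> a b c; H4_coords. Qed.
Fact H4_mulDr : right_distributive H4_mul +%R.
Proof. by move=> a b c; H4_coords. Qed.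
Fact H4_oner_neq0 : e1 != 0.
Proof.
apply/eqP => /H4P[+ _ _ _]; rewrite !H4_coordE eqxx.
by move/eqP; rewrite oner_eq0.
Qed.
Fact H4_scalerAl (c : k) a b : c *: H4_mul a b = H4_mul (c *: a) b.
Proof. by H4_coords. Qed.
Fact H4_scalerAr (c : k) a b : c *: H4_mul a b = H4_mul a (c *: b).
Proof. by H4_coords. Qed.

End Sweedler.

HB.instance Definition _ (k : fieldType) :=
  GRing.Zmodule_isNzRing.Build (H4 k) (@H4_mulA k) (@H4_mul1r k) (@H4_mulr1 k)
    (@H4_mulDl k) (@H4_mulDr k) (@H4_oner_neq0 k).
HB.instance Definition _ (k : fieldType) :=
  GRing.Lmodule_isLalgebra.Build k (H4 k) (@H4_scalerAl k).
HB.instance Definition _ (k : fieldType) :=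
  GRing.Lalgebra_isAlgebra.Build k (H4 k) (@H4_scalerAr k).

Section SweedlerHopf.
Variable k : fieldType.
Implicit Types a b : H4 k.
Notation H := (H4 k).
Notation one := (1 : H4 k).
Notation g := (eg k).
Notation x := (ex k).
Notation gx := (egx k).

Lemma H4_ext_linear (V : lmodType k) (v1 vg vx vgx : V) :
  linear (H4_ext v1 vg vx vgx).
Proof.
move=> c a b; rewrite /H4_ext !H4_coordE !scalerDl !scalerDr !scalerA.
by rewrite [RHS]addrACA; congr (_ + _); rewrite [RHS]addrACA; congr (_ + _);
   rewrite [RHS]addrACA.
Qed.

HB.instance Definition _ (V : lmodType k) (v1 vg vx vgx : V) :=
  GRing.isLinear.Build k H V _ (H4_ext v1 vg vx vgx)
    (H4_ext_linear v1 vg vx vgx).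

Lemma H4_extE (V : lmodType k) (v1 vg vx vgx : V) :
  [/\ H4_ext v1 vg vx vgx (1 : H) = v1, H4_ext v1 vg vx vgx g = vg,
      H4_ext v1 vg vx vgx x = vx & H4_ext v1 vg vx vgx gx = vgx].
Proof.
by split; rewrite /H4_ext !H4_coordE !inord4E //= !(scale0r, scale1r, add0r, addr0).
Qed.

Lemma H4_coord a : a = H4_ext (1 : H) g x gx a.
Proof. by apply/H4P; rewrite /H4_ext !H4_coordE !inord4E //=; split; ring. Qed.

Lemma H4_linear_ext (V : lmodType k) (f h : {linear H -> V}) :
  f 1 = h 1 -> f g = h g -> f x = h x -> f gx = h gx -> f =1 h.
Proof.
by move=> h1 hg hx hgx a; rewrite (H4_coord a) !linearD !linearZ /= h1 hg hx hgx.
Qed.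

Lemma H4_relations :
  [/\ g * g = 1, x * x = 0, x * g = - (g * x) & g * x = gx].
Proof.
change (@GRing.mul H) with (@H4_mul k); change (1 : H) with (e1 k).
by split; apply/H4P; rewrite !(H4_mulE, H4_coordE) !inord4E //=; split; ring.
Qed.

Definition H4_Delta : H -> tensor H H :=
  H4_ext (one \ox one) (g \ox g) (x \ox one + g \ox x) (gx \ox g + one \ox gx).

Definition H4_eps a : k := a 0 (inord 0) + a 0 (inord 1).

Definition H4_S : H -> H := H4_ext 1 g (- gx) x.

HB.instance Definition _ := GRing.Linear.copy H4_Delta
  (H4_ext (one \ox one) (g \ox g) (x \ox one + g \ox x) (gx \ox g + one \ox gx)).
HB.instance Definition _ := GRing.Linear.copy H4_S (H4_ext 1 g (- gx) x).

Lemma H4_DeltaE :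
  [/\ H4_Delta 1 = one \ox one, H4_Delta g = g \ox g,
      H4_Delta x = x \ox one + g \ox x & H4_Delta gx = gx \ox g + one \ox gx].
Proof. exact: H4_extE. Qed.

Lemma H4_epsE : [/\ H4_eps 1 = 1, H4_eps g = 1, H4_eps x = 0 & H4_eps gx = 0].
Proof. by split; rewrite /H4_eps !H4_coordE !inord4E //= ?addr0 ?add0r. Qed.

Lemma H4_epsP (c : k) a b : H4_eps (c *: a + b) = c * H4_eps a + H4_eps b.
Proof. by rewrite /H4_eps !H4_coordE; ring. Qed.

Lemma H4_SE : [/\ H4_S 1 = 1, H4_S g = g, H4_S x = - gx & H4_S gx = x].
Proof. exact: H4_extE. Qed.

Lemma lift_DeltaE (W : lmodType k) (F : H -> H -> W) :
  (forall v, linear (F^~ v)) -> (forall u, linear (F u)) ->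
  [/\ tens_lift F (H4_Delta 1) = F 1 1, tens_lift F (H4_Delta g) = F g g,
      tens_lift F (H4_Delta x) = F x 1 + F g x &
      tens_lift F (H4_Delta gx) = F gx g + F 1 gx].
Proof.
by move=> Fl Fr; case: H4_DeltaE => -> -> -> ->; rewrite !linearD /= !tens_liftE.
Qed.

Lemma H4_counit a :
  tens_lift (fun u v => H4_eps u *: v) (H4_Delta a) = a /\
  tens_lift (fun u v => H4_eps v *: u) (H4_Delta a) = a.
Proof.
have [E1 Eg Ex Egx] := H4_epsE.
split.
  pose f : {linear H -> H} :=
    tens_lift (fun u v : H => H4_eps u *: v) \o H4_Delta.
  have [||D1 Dg Dx Dgx] := lift_DeltaE (F := fun u v : H => H4_eps u *: v).
  - by move=> v c u u'; rewrite H4_epsP scalerDl scalerA.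
  - by move=> v c u u'; rewrite scalerDr !scalerA mulrC.
  by apply: (@H4_linear_ext _ f idfun);
    rewrite /= ?D1 ?Dg ?Dx ?Dgx ?E1 ?Eg ?Ex ?Egx ?scale1r ?scale0r ?add0r ?addr0.
pose f : {linear H -> H} :=
  tens_lift (fun u v : H => H4_eps v *: u) \o H4_Delta.
have [||D1 Dg Dx Dgx] := lift_DeltaE (F := fun u v : H => H4_eps v *: u).
- by move=> v c u u'; rewrite scalerDr !scalerA mulrC.
- by move=> v c u u'; rewrite H4_epsP scalerDl scalerA.
by apply: (@H4_linear_ext _ f idfun);
  rewrite /= ?D1 ?Dg ?Dx ?Dgx ?E1 ?Eg ?Ex ?Egx ?scale1r ?scale0r ?add0r ?addr0.
Qed.

Lemma H4_antipode a :
  tens_lift (fun u v : H => H4_S u * v) (H4_Delta a) = (H4_eps a)%:A /\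
  tens_lift (fun u v : H => u * H4_S v) (H4_Delta a) = (H4_eps a)%:A.
Proof.
have [E1 Eg Ex Egx] := H4_epsE; have [S1 Sg Sx Sgx] := H4_SE.
have [gg xx xg gX] := H4_relations.
have eA : linear (fun a : H => (H4_eps a)%:A : H).
  by move=> c u v; rewrite H4_epsP scalerDl scalerA.
pose h : {linear H -> H} := HB.pack (fun a : H => (H4_eps a)%:A : H)
  (GRing.isLinear.Build _ _ _ _ _ eA).
split.
  pose f : {linear H -> H} :=
    tens_lift (fun u v : H => H4_S u * v) \o H4_Delta.
  have [||D1 Dg Dx Dgx] := lift_DeltaE (F := fun u v : H => H4_S u * v).
  - by move=> v c u u'; rewrite linearP mulrDl -scalerAl.
  - by move=> v c u u'; rewrite mulrDr -scalerAr.
  apply: (@H4_linear_ext _ f h);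
    rewrite /= ?D1 ?Dg ?Dx ?Dgx ?E1 ?Eg ?Ex ?Egx ?S1 ?Sg ?Sx ?Sgx.
  - by rewrite mulr1 scale1r.
  - by rewrite gg scale1r.
  - by rewrite mulr1 gX addNr scale0r.
  - by rewrite mul1r xg gX addNr scale0r.
pose f : {linear H -> H} :=
  tens_lift (fun u v : H => u * H4_S v) \o H4_Delta.
have [||D1 Dg Dx Dgx] := lift_DeltaE (F := fun u v : H => u * H4_S v).
- by move=> v c u u'; rewrite mulrDl -scalerAl.
- by move=> v c u u'; rewrite linearP mulrDr -scalerAr.
apply: (@H4_linear_ext _ f h);
  rewrite /= ?D1 ?Dg ?Dx ?Dgx ?E1 ?Eg ?Ex ?Egx ?S1 ?Sg ?Sx ?Sgx.
- by rewrite mulr1 scale1r.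
- by rewrite gg scale1r.
- by rewrite mulr1 mulrN -gX mulrA gg mul1r subrr scale0r.
- by rewrite mul1r -gX -mulrA xg mulrN mulrA gg mul1r addNr scale0r.
Qed.

(* a_(1) (x) a_(2) (x) a_(3), i.e. (Delta (x) id) Delta. *)
Definition H4_Delta3 : H -> tensor (tensor H H) H :=
  tens_map H4_Delta idfun \o H4_Delta.

(* F(a_(1), a_(2), a_(3)) in Sweedler notation, for a trilinear F. *)
Definition sweedler3 (W : lmodType k) (F : H -> H -> H -> W) (a : H) : W :=
  tens_lift (fun (a12 : tensor H H) (a3 : H) =>
               tens_lift (fun a1 a2 => F a1 a2 a3) a12) (H4_Delta3 a).

Lemma sweedler3E (W : lmodType k) (F : H -> H -> H -> W) :
  (forall b c, linear (fun a => F a b c)) ->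
  (forall a c, linear (fun b => F a b c)) ->
  (forall a b, linear (F a b)) ->
  [/\ sweedler3 F 1 = F 1 1 1, sweedler3 F g = F g g g,
      sweedler3 F x = F x 1 1 + F g x 1 + F g g x &
      sweedler3 F gx = F gx g g + F 1 gx g + F 1 1 gx].
Proof.
move=> F1 F2 F3; have [D1 Dg Dx Dgx] := H4_DeltaE.
have lE c : [/\ _, _, _ & _] := lift_DeltaE (F1^~ c) (F2^~ c).
have lL (t : tensor H H) : linear (fun c => tens_lift (fun a b => F a b c) t).
  exact: tens_lift_linearp.
have E (u v : H) : tens_lift (fun (a12 : tensor H H) (c : H) =>
      tens_lift (fun a b => F a b c) a12) (tens_map H4_Delta idfun (u \ox v)) =
    tens_lift (fun a b => F a b v) (H4_Delta u).
  by rewrite tens_mapE tens_liftE //= => c; apply: tens_lift_linear.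
rewrite /sweedler3 /H4_Delta3 /= D1 Dg Dx Dgx !linearD /= !E.
case: (lE 1) (lE g) (lE x) (lE gx) => p1 _ px _ [_ pg _ pgx] [_ qg _ _] [q1 _ _ _].
by split; rewrite ?p1 ?pg ?px ?pgx ?qg ?q1.
Qed.

Definition tens_assoc : tensor (tensor H H) H -> tensor H (tensor H H) :=
  tens_lift (fun (t : tensor H H) (c : H) =>
               tens_lift (fun (a : H) (b : H) => a \ox (b \ox c)) t).

Definition tens_mul (s t : tensor H H) : tensor H H :=
  tens_lift (fun a b : H =>
    tens_lift (fun c d : H => (a * c) \ox (b * d)) t) s.

HB.instance Definition _ := GRing.Linear.copy tens_assoc
  (tens_lift (fun (t : tensor H H) (c : H) =>
               tens_lift (fun (a : H) (b : H) => a \ox (b \ox c)) t)).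

Lemma tens_assocE (a b c : H) : tens_assoc (a \ox b \ox c) = a \ox (b \ox c).
Proof.
have L (v c' : H) : linear (fun u : H => u \ox (v \ox c')) by exact: tens_linearl.
have R (u c' : H) : linear (fun v : H => u \ox (v \ox c')).
  by move=> d v v'; rewrite tens_linearl tens_linearr.
rewrite /tens_assoc tens_liftE ?tens_liftE // => [v'|t].
  exact: tens_lift_linear.
apply: (tens_lift_linearp (F := fun c a b => a \ox (b \ox c))) => u v d w w'.
by rewrite !tens_linearr.
Qed.

Lemma H4_coassoc a :
  tens_assoc (tens_map H4_Delta idfun (H4_Delta a)) =
  tens_map idfun H4_Delta (H4_Delta a).
Proof.
pose f : {linear H -> tensor H (tensor H H)} :=
  tens_assoc \o (tens_map H4_Delta idfun \o H4_Delta).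
pose h : {linear H -> tensor H (tensor H H)} :=
  tens_map idfun H4_Delta \o H4_Delta.
have [D1 Dg Dx Dgx] := H4_DeltaE.
have lD (u v w : H) : (u + v) \ox w = u \ox w + v \ox w.
  by have := tens_linearl w 1 u v; rewrite !scale1r.
have lD2 (u v : tensor H H) (w : H) : (u + v) \ox w = u \ox w + v \ox w.
  by have := tens_linearl w 1 u v; rewrite !scale1r.
have rD2 (w : H) (u v : tensor H H) : w \ox (u + v) = w \ox u + w \ox v.
  by have := tens_linearr w 1 u v; rewrite !scale1r.
apply: (@H4_linear_ext _ f h); rewrite /= ?D1 ?Dg ?Dx ?Dgx ?linearD /= ?tens_mapE /=
  ?D1 ?Dg ?Dx ?Dgx ?lD2 ?rD2 ?linearD /= ?tens_assocE //=; by rewrite ?addrA.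
Qed.

Lemma tens_mulE (a b c d : H) :
  tens_mul (a \ox b) (c \ox d) = (a * c) \ox (b * d).
Proof.
rewrite /tens_mul tens_liftE ?tens_liftE //.
- by move=> v u w w'; rewrite mulrDr -scalerAr tens_linearl.
- by move=> v u w w'; rewrite mulrDr -scalerAr tens_linearr.
- move=> v; apply: (tens_lift_linearp (F := fun a c d => (a * c) \ox (v * d))).
  by move=> u w e p p'; rewrite mulrDl -scalerAl tens_linearl.
- move=> u; apply: (tens_lift_linearp (F := fun b c d => (u * c) \ox (b * d))).
  by move=> v w e p p'; rewrite mulrDl -scalerAl tens_linearr.
Qed.

Lemma tens_mul_linearl (t : tensor H H) : linear (tens_mul^~ t).
Proof. exact: tens_lift_linear. Qed.

Lemma tens_mul_linearr (s : tensor H H) : linear (tens_mul s).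
Proof.
by apply: tens_lift_linearp => u v; apply: tens_lift_linear.
Qed.

Lemma H4_mul_table :
  (g * g = one) * (g * x = gx) * (g * gx = x) *
  (x * g = - gx) * (x * x = 0) * (x * gx = 0) *
  (gx * g = - x) * (gx * x = 0) * (gx * gx = 0).
Proof.
change (@GRing.mul H) with (@H4_mul k); change one with (e1 k).
by do !split; apply/H4P; rewrite !(H4_mulE, H4_coordE) !inord4E //=; split; ring.
Qed.

Lemma H4_DeltaM a b : H4_Delta (a * b) = tens_mul (H4_Delta a) (H4_Delta b).
Proof.
have lD (s s' t : tensor H H) :
    tens_mul (s + s') t = tens_mul s t + tens_mul s' t.
  by have := tens_mul_linearl t 1 s s'; rewrite !scale1r.
have rD (s t t' : tensor H H) :
    tens_mul s (t + t') = tens_mul s t + tens_mul s t'.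
  by have := tens_mul_linearr s 1 t t'; rewrite !scale1r.
have Ll (c : H) : linear (fun a : H => H4_Delta (a * c)).
  by move=> d u v; rewrite mulrDl -scalerAl linearP.
have Lr (c : H) : linear (fun b : H => tens_mul (H4_Delta c) (H4_Delta b)).
  by move=> d u v; rewrite linearP tens_mul_linearr.
have Rl (c : H) : linear (fun b : H => H4_Delta (c * b)).
  by move=> d u v; rewrite mulrDr -scalerAr linearP.
have Rr (c : H) : linear (fun a : H => tens_mul (H4_Delta a) (H4_Delta c)).
  by move=> d u v; rewrite linearP tens_mul_linearl.
pose L1 c : {linear H -> tensor H H} := HB.pack (fun a : H => H4_Delta (a * c))
  (GRing.isLinear.Build _ _ _ _ _ (Ll c)).
pose L2 c : {linear H -> tensor H H} :=
  HB.pack (fun a : H => tens_mul (H4_Delta a) (H4_Delta c))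
  (GRing.isLinear.Build _ _ _ _ _ (Rr c)).
pose R1 c : {linear H -> tensor H H} := HB.pack (fun b : H => H4_Delta (c * b))
  (GRing.isLinear.Build _ _ _ _ _ (Rl c)).
pose R2 c : {linear H -> tensor H H} :=
  HB.pack (fun b : H => tens_mul (H4_Delta c) (H4_Delta b))
  (GRing.isLinear.Build _ _ _ _ _ (Lr c)).
have [D1 Dg Dx Dgx] := H4_DeltaE.
apply: (@H4_linear_ext _ (L1 b) (L2 b)) => /=;
  [move: b; apply: (@H4_linear_ext _ (R1 1) (R2 1))
  |move: b; apply: (@H4_linear_ext _ (R1 g) (R2 g))
  |move: b; apply: (@H4_linear_ext _ (R1 x) (R2 x))
  |move: b; apply: (@H4_linear_ext _ (R1 gx) (R2 gx))] => /=;
  rewrite ?mulr1 ?mul1r ?H4_mul_table ?linearN ?linear0 /= ?D1 ?Dg ?Dx ?Dgx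
    ?(lD, rD, tens_mulE) ?mulr1 ?mul1r ?H4_mul_table;
  apply/matrixP => i j; rewrite !mxE ?linearN ?linear0 /=; ring.
Qed.

Lemma H4_epsM a b : H4_eps (a * b) = H4_eps a * H4_eps b.
Proof.
change (@GRing.mul H) with (@H4_mul k).
by rewrite /H4_eps !H4_mulE; ring.
Qed.

Definition CH_RB_operator (B : {linear H -> H}) : Prop :=
  forall a b,
    B a * B b =
    B (sweedler3 (fun a1 a2 a3 => a1 * B a2 * b * H4_S (B a3)) a).

(* Only compatibility with Delta; no condition on the counit. *)
Definition coalgebra_hom (B : {linear H -> H}) : Prop :=
  forall a, tens_map B B (H4_Delta a) = H4_Delta (B a).

End SweedlerHopf.

(* Main.v *)
(* The span J of x and gx is an ideal with J J = 0 and S(J) contained in J,   *)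
(* so for any linear B with values in J both sides of the Rota-Baxter         *)
(* identity vanish. Taking B(1) = x breaks comultiplicativity at 1, since     *)
(* the grouplike element 1 is sent to x, which is not grouplike.              *)
Require Import Defs.
From mathcomp Require Import all_boot all_algebra.

Set Implicit Arguments.
Unset Strict Implicit.
Unset Printing Implicit Defensive.

Import GRing.Theory.
Local Open Scope ring_scope.

(** Let [B a] be [ex k] times the coefficient of [1] in [a]. The left side vanishes since x x = 0;
    on the right, every term inside [B] has a factor x b S(x), zero by [ex_mul_S_ex]. At [1],
    comultiplicativity would make [ex k] grouplike. *)

Lemma sweedler3_eq0 (k : fieldType) (W : lmodType k)
    (F : H4 k -> H4 k -> H4 k -> W) (a : H4 k) :
  (forall u v w, F u v w = 0) -> sweedler3 F a = 0.
Proof.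
move=> F0; rewrite /sweedler3 /tens_lift big1 // => i _; rewrite big1 // => j _.
by rewrite big1 ?scaler0 // => i' _; rewrite big1 // => j' _; rewrite F0 scaler0.
Qed.

Lemma ex_mul_S_ex (k : fieldType) (b : H4 k) : ex k * b * H4_S (ex k) = 0.
Proof.
have [_ _ -> _] := H4_SE k; rewrite (H4_coord b) /H4_ext.
rewrite !mulrDr -!scalerAr mulr1 !H4_mul_table !mulrDl -!scalerAl !mulrN !mulNr.
by rewrite !H4_mul_table !(mul0r, oppr0, scaler0, addr0).
Qed.

Lemma ex_neq0 (k : fieldType) : ex k != 0.
Proof.
apply/eqP => /H4P[_ _ + _]; rewrite !H4_coordE eqxx.
by move/eqP; rewrite oner_eq0.
Qed.

(** Otherwise the counit law would give [ex k = H4_eps (ex k) *: ex k], which is zero. *)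
Lemma ex_not_grouplike (k : fieldType) : ex k \ox ex k <> H4_Delta (ex k).
Proof.
move=> E; have [+ _] := H4_counit (ex k); rewrite -E tens_liftE.
- have [_ _ -> _] := H4_epsE k; rewrite scale0r => /esym/eqP.
  by rewrite (negPf (ex_neq0 k)).
- by move=> v c u u'; rewrite H4_epsP scalerDl scalerA.
- by move=> v c u u'; rewrite scalerDr !scalerA mulrC.
Qed.

Theorem proposition4p3 (k : fieldType) :
  exists B : {linear H4 k -> H4 k},
    CH_RB_operator B /\ ~ coalgebra_hom B.
Proof.
pose B : {linear H4 k -> H4 k} := H4_ext (ex k) 0 0 0.
have BE a : B a = a 0 (inord 0) *: ex k by rewrite /B /= /H4_ext !scaler0 !addr0.
exists B; split=> [a b | /(_ 1)].
  rewrite sweedler3_eq0 => [|u v w].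
    by rewrite linear0 !BE -scalerAl -scalerAr H4_mul_table !scaler0.
  rewrite !BE linearZ /= -!scalerAr -!scalerAl -!mulrA.
  by rewrite [ex k * _]mulrA ex_mul_S_ex mulr0 !scaler0.
have B1 : B 1 = ex k by case: (H4_extE (ex k) 0 0 0).
have [-> _ _ _] := H4_DeltaE k.
by rewrite tens_mapE B1; apply: ex_not_grouplike.
Qed.
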